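(* Let $\mathcal D_1$ and $\mathcal D_2$ be compactly generated triangulated categories, and let $\varphi_*:\mathcal D_2\to\mathcal D_1$ be a triangle functor with a left adjoint $\varphi^*:\mathcal D_1\to\mathcal D_2$. Suppose that $\varphi_*$ preserves coproducts and that the adjunction $\varphi^*\dashv\varphi_*$ is quasi faithfully flat. Let $T_1\in\mathcal D_1$ and put $T_2=\varphi^*T_1$. Suppose that $T_1$ is a generator of $\mathcal D_1$ and that $T_1[<0]^\perp$ is closed under pure subobjects and coproducts. If $T_2$ is a silting object in $\mathcal D_2$, then $T_1$ is silting in $\mathcal D_1$. In particular, the hypotheses on $T_1$ (that $T_1$ is a generator of $\mathcal D_1$ and that $T_1[<0]^\perp$ is closed under pure subobjects and coproducts) are satisfied provided that $T_1$ is a compact generator of $\mathcal D_1$; in this case $T_2$ is also a compact generator of $\mathcal D_2$.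
   Context: For an object $X$ of a triangulated category $\mathcal D$ and $N\subseteq\mathbb Z$, $X[N]=\{X[n]\mid n\in N\}$; $[<0]$, $[\ge 0]$, etc. denote the corresponding subsets $N$. For a class $\mathcal X$ of objects, $\mathcal X^\perp=\{Y\mid \mathcal D(X,Y)=0\ \forall X\in\mathcal X\}$. An object $T$ is a generator of $\mathcal D$ if $T[\mathbb Z]^\perp=\{0\}$. An object $P$ is compact if $\mathcal D(P,-)$ preserves coproducts. A torsion pair is a pair $(\mathcal U,\mathcal V)$ of full subcategories closed under direct summands with $\mathcal D(\mathcal U,\mathcal V)=0$ such that every $X$ lies in a triangle $U\to X\to V\to U[1]$ with $U\in\mathcal U$, $V\in\mathcal V$; it is a t-structure if $\mathcal U[1]\subseteq\mathcal U$. $T$ is silting if $(T[<0]^\perp,T[\ge0]^\perp)$ is a t-structure. $\mathcal D$ (with coproducts) is compactly generated if the full subcategory $\mathcal D^c$ of compact objects is essentially small and $(\mathcal D^c)^\perp=0$. A morphism $f$ in such a $\mathcal D$ is phantom if $\mathcal D(P,f)=0$ for every compact $P$. A triangle $X\to Y\to Z\xrightarrow{f}X[1]$ is pure if $0\to\mathcal D(P,X)\to\mathcal D(P,Y)\to\mathcal D(P,Z)\to0$ is exact for all compact $P$ (equivalently $f$ is phantom); then $X$ is called a pure subobject of $Y$. The adjunction $\varphi^*\dashv\varphi_*$ is quasi faithfully flat if $\varphi^*$ reflects phantom maps: whenever $\varphi^*f$ is phantom in $\mathcal D_2$, $f$ is phantom in $\mathcal D_1$.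
   Formalization: That T_2 is a generator of D_2 is claimed only when T_2 is silting (its compactness is unconditional); without this it fails, e.g. D_2 = D_1 × D' with D' ≠ 0, φ_* the projection and T_2 = (T_1, 0). *)

(* Defs.v *)
From HB Require Import structures.
From mathcomp Require Import all_boot all_order all_algebra.

Set Implicit Arguments.
Unset Strict Implicit.
Unset Printing Implicit Defensive.

Import GRing.Theory.
Local Open Scope ring_scope.

(* Size convention: [small] is the universe in which the carrier of a [zmodType]
   lives, hence the universe of the Hom-groups below.  Coproducts are indexed by,
   and essential smallness is witnessed by, types of this same universe.  So
   categories are locally small with set-indexed coproducts; indexing over a
   strictly larger universe would force all Hom-groups to be trivial. *)
Definition small := Type@{Algebra.Zmodule.axioms_.u0}.

Record preadditive := Preadditive {
  obj :> Type;
  hom : obj -> obj -> zmodType;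
  idm : forall X, hom X X;
  comp : forall X Y Z, hom Y Z -> hom X Y -> hom X Z;
  compA : forall W X Y Z (h : hom Y Z) (g : hom X Y) (f : hom W X),
    comp h (comp g f) = comp (comp h g) f;
  comp1m : forall X Y (f : hom X Y), comp (idm Y) f = f;
  compm1 : forall X Y (f : hom X Y), comp f (idm X) = f;
  compDl : forall X Y Z (g g' : hom Y Z) (f : hom X Y),
    comp (g + g') f = comp g f + comp g' f;
  compDr : forall X Y Z (g : hom Y Z) (f f' : hom X Y),
    comp g (f + f') = comp g f + comp g f'
}.

Notation "g \oc f" := (comp g f) (at level 40, left associativity).

Lemma comp_zmod_morphism (C : preadditive) (W X Y : C) (f : hom X Y) :
  zmod_morphism (@comp C W X Y f).
Proof.
move=> a b; apply: (@addIr _ (f \oc b)).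
by rewrite -compDr !subrK.
Qed.

HB.instance Definition _ (C : preadditive) (W X Y : C) (f : hom X Y) :=
  GRing.isZmodMorphism.Build (hom W X) (hom W Y) (@comp C W X Y f)
    (@comp_zmod_morphism C W X Y f).

Section Preadditive.
Variable C : preadditive.

Definition is_iso (X Y : C) (f : hom X Y) : Prop :=
  exists g : hom Y X, g \oc f = idm X /\ f \oc g = idm Y.

Definition isomorphic (X Y : C) : Prop := exists f : hom X Y, is_iso f.

Definition is_zero (X : C) : Prop :=
  forall Y : C, (forall f : hom X Y, f = 0) /\ (forall f : hom Y X, f = 0).

Definition is_biproduct (A B X : C) (i1 : hom A X) (i2 : hom B X)
    (p1 : hom X A) (p2 : hom X B) : Prop :=
  [/\ p1 \oc i1 = idm A, p2 \oc i2 = idm B, p1 \oc i2 = 0, p2 \oc i1 = 0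
    & i1 \oc p1 + i2 \oc p2 = idm X].

Definition is_additive : Prop :=
  (exists O : C, is_zero O) /\
  (forall A B : C, exists (X : C) (i1 : hom A X) (i2 : hom B X)
     (p1 : hom X A) (p2 : hom X B), is_biproduct i1 i2 p1 p2).

Definition direct_summand (A X : C) : Prop :=
  exists (B : C) (i1 : hom A X) (i2 : hom B X) (p1 : hom X A) (p2 : hom X B),
    is_biproduct i1 i2 p1 p2.

Definition is_coproduct (I : small) (X : I -> C) (S : C)
    (inj : forall i, hom (X i) S) : Prop :=
  forall (Y : C) (g : forall i, hom (X i) Y),
    exists! h : hom S Y, forall i, h \oc inj i = g i.

Definition has_coproducts : Prop :=
  forall (I : small) (X : I -> C),
    exists (S : C) (inj : forall i, hom (X i) S), is_coproduct inj.

End Preadditive.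

Record functor (C D : preadditive) := Functor {
  fobj :> C -> D;
  fmap : forall X Y, hom X Y -> hom (fobj X) (fobj Y);
  fmap_id : forall X, fmap (idm X) = idm (fobj X);
  fmap_comp : forall X Y Z (g : hom Y Z) (f : hom X Y),
    fmap (g \oc f) = fmap g \oc fmap f
}.

Definition functor_id (C : preadditive) : functor C C :=
  @Functor C C id (fun _ _ f => f) (fun _ => erefl) (fun _ _ _ _ _ => erefl).

Lemma functor_comp_id (C D E : preadditive) (G : functor D E) (F : functor C D)
    (X : C) : fmap G (fmap F (idm X)) = idm (G (F X)).
Proof. by rewrite !fmap_id. Qed.

Lemma functor_comp_comp (C D E : preadditive) (G : functor D E)
    (F : functor C D) (X Y Z : C) (g : hom Y Z) (f : hom X Y) :
  fmap G (fmap F (g \oc f)) = fmap G (fmap F g) \oc fmap G (fmap F f).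
Proof. by rewrite !fmap_comp. Qed.

Definition functor_comp (C D E : preadditive) (G : functor D E)
    (F : functor C D) : functor C E :=
  @Functor C E (fun X => G (F X)) (fun _ _ f => fmap G (fmap F f))
    (functor_comp_id G F) (@functor_comp_comp C D E G F).

Definition additive_functor (C D : preadditive) (F : functor C D) : Prop :=
  forall X Y : C, zmod_morphism (@fmap C D F X Y).

Definition natural (C D : preadditive) (F G : functor C D)
    (a : forall X, hom (F X) (G X)) : Prop :=
  forall (X Y : C) (f : hom X Y), a Y \oc fmap F f = fmap G f \oc a X.

Definition natural_iso (C D : preadditive) (F G : functor C D)
    (a : forall X, hom (F X) (G X)) : Prop :=
  natural a /\ forall X, is_iso (a X).

Definition quasi_inverse (C D : preadditive) (F : functor C D)
    (G : functor D C) : Prop :=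
  (exists eta : forall X, hom (functor_id C X) (functor_comp G F X),
     natural_iso eta) /\
  (exists eps : forall Y, hom (functor_comp F G Y) (functor_id D Y),
     natural_iso eps).

(* [adjunction F G] : F is left adjoint to G. *)
Record adjunction (C D : preadditive) (F : functor C D) (G : functor D C) :=
  Adjunction {
    unit : forall X : C, hom (functor_id C X) (functor_comp G F X);
    counit : forall Y : D, hom (functor_comp F G Y) (functor_id D Y);
    unit_natural : natural unit;
    counit_natural : natural counit;
    unit_counit : forall X : C, counit (F X) \oc fmap F (unit X) = idm (F X);
    counit_unit : forall Y : D, fmap G (counit Y) \oc unit (G Y) = idm (G Y)
  }.

Definition preserves_coproducts (C D : preadditive) (F : functor C D) : Prop :=
  forall (I : small) (X : I -> C) (S : C) (inj : forall i, hom (X i) S),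
    is_coproduct inj -> is_coproduct (fun i => fmap F (inj i)).

Definition is_zmod_coproduct (I : small) (A : I -> zmodType) (B : zmodType)
    (inj : forall i, {additive A i -> B}) : Prop :=
  forall (M : zmodType) (g : forall i, {additive A i -> M}),
    exists h : {additive B -> M}, (forall i a, h (inj i a) = g i a) /\
      (forall h' : {additive B -> M},
         (forall i a, h' (inj i a) = g i a) -> h' =1 h).

Definition compact (C : preadditive) (P : C) : Prop :=
  forall (I : small) (X : I -> C) (S : C) (inj : forall i, hom (X i) S),
    is_coproduct inj ->
    is_zmod_coproduct
      (fun i => comp (inj i) : {additive hom P (X i) -> hom P S}).

(* The suspension is an auto-equivalence with a chosen quasi-inverse, so that
   X[n] is defined on objects for every integer n.  [tri_octahedral] is the
   octahedral axiom for the composable pair f, g, with the three chosen cones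
   (Q1 of f, Q2 of g f, Q3 of g). *)
Record triangulated := Triangulated {
  tri_cat :> preadditive;
  tri_additive : is_additive tri_cat;
  susp : functor tri_cat tri_cat;
  desusp : functor tri_cat tri_cat;
  susp_additive : additive_functor susp;
  susp_desusp : quasi_inverse susp desusp;
  dist : forall X Y Z : tri_cat,
    hom X Y -> hom Y Z -> hom Z (susp X) -> Prop;
  tri_iso : forall (X Y Z X' Y' Z' : tri_cat)
      (f : hom X Y) (g : hom Y Z) (h : hom Z (susp X))
      (f' : hom X' Y') (g' : hom Y' Z') (h' : hom Z' (susp X'))
      (a : hom X X') (b : hom Y Y') (c : hom Z Z'),
    is_iso a -> is_iso b -> is_iso c ->
    b \oc f = f' \oc a -> c \oc g = g' \oc b ->
    fmap susp a \oc h = h' \oc c ->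
    dist f g h -> dist f' g' h';
  tri_id : forall (X O : tri_cat), is_zero O ->
    dist (idm X) (0 : hom X O) (0 : hom O (susp X));
  tri_cone : forall (X Y : tri_cat) (f : hom X Y),
    exists (Z : tri_cat) (g : hom Y Z) (h : hom Z (susp X)), dist f g h;
  tri_rotate : forall (X Y Z : tri_cat)
      (f : hom X Y) (g : hom Y Z) (h : hom Z (susp X)),
    dist f g h <-> dist g h (- fmap susp f);
  tri_morphism : forall (X Y Z X' Y' Z' : tri_cat)
      (f : hom X Y) (g : hom Y Z) (h : hom Z (susp X))
      (f' : hom X' Y') (g' : hom Y' Z') (h' : hom Z' (susp X'))
      (a : hom X X') (b : hom Y Y'),
    dist f g h -> dist f' g' h' -> b \oc f = f' \oc a ->
    exists c : hom Z Z',
      c \oc g = g' \oc b /\ fmap susp a \oc h = h' \oc c;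
  tri_octahedral : forall (X Y Z Q1 Q2 Q3 : tri_cat)
      (f : hom X Y) (p1 : hom Y Q1) (d1 : hom Q1 (susp X))
      (g : hom Y Z) (p3 : hom Z Q3) (d3 : hom Q3 (susp Y))
      (p2 : hom Z Q2) (d2 : hom Q2 (susp X)),
    dist f p1 d1 -> dist (g \oc f) p2 d2 -> dist g p3 d3 ->
    exists (u : hom Q1 Q2) (v : hom Q2 Q3),
      [/\ dist u v (fmap susp p1 \oc d3),
          u \oc p1 = p2 \oc g, d2 \oc u = d1,
          v \oc p2 = p3 & d3 \oc v = fmap susp f \oc d2]
}.

Record triangle_functor (C D : triangulated) := TriangleFunctor {
  tfunctor :> functor C D;
  tfunctor_additive : additive_functor tfunctor;
  tfunctor_susp : forall X : C, hom (functor_comp tfunctor (susp C) X)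
                                    (functor_comp (susp D) tfunctor X);
  tfunctor_susp_iso : natural_iso tfunctor_susp;
  tfunctor_dist : forall (X Y Z : C)
      (f : hom X Y) (g : hom Y Z) (h : hom Z (susp C X)),
    dist f g h ->
    dist (fmap tfunctor f) (fmap tfunctor g) (tfunctor_susp X \oc fmap tfunctor h)
}.

Section Triangulated.
Variable D : triangulated.

Definition shift (n : int) (X : D) : D :=
  match n with
  | Posz m => iter m (susp D) X
  | Negz m => iter m.+1 (desusp D) X
  end.

(* Classes of objects, equivalently full subcategories, are predicates. *)
Definition shifts (T : D) (N : int -> Prop) : D -> Prop :=
  fun X => exists2 n, N n & X = shift n T.

Definition perp (XX : D -> Prop) : D -> Prop :=
  fun Y => forall X, XX X -> forall f : hom X Y, f = 0.

Definition perp_is_zero (XX : D -> Prop) : Prop :=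
  forall Y : D, perp XX Y <-> is_zero Y.

Definition generator (T : D) : Prop :=
  perp_is_zero (shifts T (fun _ => True)).

Definition compact_generator (T : D) : Prop := compact T /\ generator T.

Definition closed_summands (U : D -> Prop) : Prop :=
  forall A X : D, direct_summand A X -> U X -> U A.

Definition closed_coproducts (U : D -> Prop) : Prop :=
  forall (I : small) (X : I -> D) (S : D) (inj : forall i, hom (X i) S),
    is_coproduct inj -> (forall i, U (X i)) -> U S.

Definition torsion_pair (U V : D -> Prop) : Prop :=
  [/\ closed_summands U, closed_summands V,
      (forall A B : D, U A -> V B -> forall f : hom A B, f = 0)
    & forall X : D, exists (A B : D) (f : hom A X) (g : hom X B)
        (h : hom B (susp D A)), [/\ U A, V B & dist f g h]].

Definition t_structure (U V : D -> Prop) : Prop :=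
  torsion_pair U V /\ (forall X : D, U X -> U (shift 1 X)).

Definition silting (T : D) : Prop :=
  t_structure (perp (shifts T (fun n => n < 0)))
              (perp (shifts T (fun n => 0 <= n))).

Definition essentially_small (U : D -> Prop) : Prop :=
  exists (J : small) (E : J -> D),
    (forall j, U (E j)) /\ (forall X, U X -> exists j, isomorphic X (E j)).

Definition compactly_generated : Prop :=
  [/\ has_coproducts D, essentially_small (@compact D)
    & perp_is_zero (@compact D)].

Definition phantom (X Y : D) (f : hom X Y) : Prop :=
  forall P : D, compact P -> forall g : hom P X, f \oc g = 0.

Definition short_exact (A B M : zmodType) (f : {additive A -> B})
    (g : {additive B -> M}) : Prop :=
  [/\ injective f, (forall b, g b = 0 <-> exists a, f a = b)
    & forall m, exists b, g b = m].

Definition pure_triangle (X Y Z : D) (f : hom X Y) (g : hom Y Z)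
    (h : hom Z (susp D X)) : Prop :=
  dist f g h /\
  forall P : D, compact P ->
    short_exact (comp f : {additive hom P X -> hom P Y})
                (comp g : {additive hom P Y -> hom P Z}).

Definition pure_subobject (X Y : D) : Prop :=
  exists (Z : D) (f : hom X Y) (g : hom Y Z) (h : hom Z (susp D X)),
    pure_triangle f g h.

Definition closed_pure_subobjects (U : D -> Prop) : Prop :=
  forall X Y : D, pure_subobject X Y -> U Y -> U X.

End Triangulated.

Definition reflects_phantoms (C D : triangulated) (F : functor C D) : Prop :=
  forall (X Y : C) (f : hom X Y), phantom (fmap F f) -> phantom f.

Definition quasi_faithfully_flat (C D : triangulated) (F : functor C D)
    (G : functor D C) (adj : adjunction F G) : Prop :=
  reflects_phantoms F.

(* Main.v *)
(** The unit T1 -> phi_low (phi_up T1) becomes a split monomorphism under phi_up,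
    so every map it kills is phantom and T1 is a pure subobject of
    phi_low (phi_up T1).  That object lies in T1[<0]^perp, because T2 silting
    forces T2 to lie in T2[<0]^perp; by purity so does T1.

    It remains to see that a generator T in T[<0]^perp is silting as soon as
    T[<0]^perp is closed under coproducts.  Given X, build maps A_k -> X with cones
    B_k, attaching at step k a coproduct of copies of T[k] that kills all maps
    T[k] -> B_k; since T is in T[<0]^perp this does not revive maps from T[j], j < k.
    The cone of A_k -> A_(k+1) has no maps from T[j], j < k, which makes maps from a
    fixed T[j] to the homotopy colimit L of the A_k factor through a finite
    stage, although T need not be compact.  So the cone of L -> X lies in
    T[>=0]^perp, while L is in T[<0]^perp and has no maps to T[>=0]^perp. *)
From HB Require Import structures.
From mathcomp Require Import all_boot all_order all_algebra.
From mathcomp Require Import zify.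
From Stdlib Require Import IndefiniteDescription.
Require Import Defs.

Set Implicit Arguments.
Unset Strict Implicit.
Unset Printing Implicit Defensive.

Import GRing.Theory.
Local Open Scope ring_scope.

(** * Preadditive categories and equivalences *)

Section PreadditiveTheory.
Variable C : preadditive.
Implicit Types W X Y Z : C.

Lemma comp0l W X Y (f : hom W X) : (0 : hom X Y) \oc f = 0.
Proof. by apply: (@addIr _ (0 \oc f)); rewrite -compDl !add0r. Qed.

Lemma comp0r W X Y (g : hom X Y) : g \oc (0 : hom W X) = 0.
Proof. by rewrite raddf0. Qed.

Lemma compNl W X Y (g : hom X Y) (f : hom W X) : (- g) \oc f = - (g \oc f).
Proof. by apply: (@addIr _ (g \oc f)); rewrite -compDl !addNr comp0l. Qed.

Lemma compNr W X Y (g : hom X Y) (f : hom W X) : g \oc (- f) = - (g \oc f).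
Proof. by rewrite raddfN. Qed.

Lemma compBl W X Y (g g' : hom X Y) (f : hom W X) :
  (g - g') \oc f = g \oc f - g' \oc f.
Proof. by rewrite compDl compNl. Qed.

Lemma compBr W X Y (g : hom X Y) (f f' : hom W X) :
  g \oc (f - f') = g \oc f - g \oc f'.
Proof. by rewrite compDr compNr. Qed.

Lemma iso_id X : is_iso (idm X).
Proof. by exists (idm X); rewrite !comp1m. Qed.

Lemma iso_opp X : is_iso (- idm X).
Proof. by exists (- idm X); rewrite compNl compNr opprK comp1m. Qed.

Lemma isomorphic_sym X Y : isomorphic X Y -> isomorphic Y X.
Proof. by move=> [f [g [gf fg]]]; exists g, f. Qed.

Definition orth X Y : Prop := forall f : hom X Y, f = 0.

Lemma orth_isol X X' Y : isomorphic X X' -> orth X Y -> orth X' Y.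
Proof.
move=> [f [g [_ fg]]] oXY u.
by rewrite -[u]compm1 -fg compA (oXY (u \oc f)) comp0l.
Qed.

Lemma orth_isor X Y Y' : isomorphic Y Y' -> orth X Y -> orth X Y'.
Proof.
move=> [f [g [_ fg]]] oXY u.
by rewrite -[u]comp1m -fg -compA (oXY (g \oc u)) comp0r.
Qed.

Lemma orth_summand X A Y : direct_summand A Y -> orth X Y -> orth X A.
Proof.
move=> [B [i [j [p [q [pi _ _ _ _]]]]]] oXY u.
by rewrite -[u]comp1m -pi -compA (oXY (i \oc u)) comp0r.
Qed.

Lemma is_zero_id X : idm X = 0 -> is_zero X.
Proof.
move=> X0 Y; split=> f; first by rewrite -[f]compm1 X0 comp0r.
by rewrite -[f]comp1m X0 comp0l.
Qed.

Section Coproduct.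
Variables (I : small) (X : I -> C) (S : C) (inj : forall i, hom (X i) S).
Hypothesis Sco : is_coproduct inj.

Lemma coprod_ext Y (f g : hom S Y) :
  (forall i, f \oc inj i = g \oc inj i) -> f = g.
Proof.
move=> fg; have [h [_ hu]] := Sco (fun i => g \oc inj i).
by rewrite -(hu f) // -(hu g).
Qed.

Lemma coprod_desc Y (g : forall i, hom (X i) Y) :
  exists h : hom S Y, forall i, h \oc inj i = g i.
Proof. by have [h [hi _]] := Sco g; exists h. Qed.

Lemma orth_coprod Y : (forall i, orth (X i) Y) -> orth S Y.
Proof.
by move=> oXY f; apply: coprod_ext => i; rewrite comp0l; apply: oXY.
Qed.

End Coproduct.

Lemma is_coproductP (I : small) (X : I -> C) S (inj : forall i, hom (X i) S) :
  (forall Y (g : forall i, hom (X i) Y), exists h : hom S Y,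
     forall i, h \oc inj i = g i) ->
  (forall Y (f g : hom S Y),
     (forall i, f \oc inj i = g \oc inj i) -> f = g) ->
  is_coproduct inj.
Proof.
move=> ex un Y g; have [h hi] := ex Y g; exists h; split=> // h' h'i.
by apply: un => i; rewrite hi h'i.
Qed.

End PreadditiveTheory.

Lemma additive_fmap0 (C D : preadditive) (F : functor C D) :
  additive_functor F -> forall X Y : C, fmap F (0 : hom X Y) = 0.
Proof. by move=> Fadd X Y; rewrite -[0 in LHS]subr0 Fadd subrr. Qed.

Lemma additive_fmapN (C D : preadditive) (F : functor C D) :
  additive_functor F -> forall (X Y : C) (f : hom X Y), fmap F (- f) = - fmap F f.
Proof.
by move=> Fadd X Y f; rewrite -sub0r Fadd additive_fmap0 // sub0r.
Qed.

Section Equivalence.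
Variables (C D : preadditive) (F : functor C D) (G : functor D C).
Hypothesis FG : quasi_inverse F G.

Lemma quasi_inverse_unit (X : C) : isomorphic X (G (F X)).
Proof. by have [[eta [_ etai]] _] := FG; exists (eta X); apply: etai. Qed.

Lemma quasi_inverse_counit (Y : D) : isomorphic (F (G Y)) Y.
Proof. by have [_ [eps [_ epsi]]] := FG; exists (eps Y); apply: epsi. Qed.

Lemma quasi_inverse_sym : quasi_inverse G F.
Proof.
(* [is_iso] only asserts that an inverse exists, so inverses are chosen pointwise; their naturality
   then follows from that of [a]. *)
have inv (E : preadditive) (H K : functor E E) (a : forall X, hom (H X) (K X)) :
    natural_iso a -> exists b : forall X, hom (K X) (H X), natural_iso b.
  move=> [anat aiso].
  pose b X := constructive_indefinite_description _ (aiso X).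
  exists (fun X => sval (b X)); split=> [X Y f|X]; last first.
    by case: (b X) => g /= [ga ag]; exists (a X).
  case: (b X) (b Y) => g [/= ga ag] [g' [/= ga' ag']].
  rewrite -[fmap K f]compm1 -ag (compA (fmap K f)) -anat -(compA (a Y)).
  by rewrite (compA g') ga' comp1m.
have [[eta ei] [eps ep]] := FG; split; first exact: (inv _ _ _ eps).
exact: (inv _ _ _ eta).
Qed.

Lemma quasi_inverse_faithful (X Y : C) (f g : hom X Y) :
  fmap F f = fmap F g -> f = g.
Proof.
have [[eta [etan etai]] _] := FG => Ffg.
have [e [ee _]] := etai Y.
rewrite -[f]comp1m -[g]comp1m -ee -!compA (etan _ _ f) (etan _ _ g) /=.
by rewrite Ffg.
Qed.

End Equivalence.

Section EquivalenceFull.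
Variables (C D : preadditive) (F : functor C D) (G : functor D C).
Hypothesis FG : quasi_inverse F G.

(** [G] is faithful too, so it is enough to compare images under [G]; there naturality of [eta],
    whose components are invertible, identifies [G (F f)] with [G g]. *)
Lemma quasi_inverse_full (X Y : C) (g : hom (F X) (F Y)) :
  exists f : hom X Y, g = fmap F f.
Proof.
have [[eta [etan etai]] _] := FG.
have [e [ee ee']] := etai Y.
exists (e \oc fmap G g \oc eta X).
apply: (quasi_inverse_faithful (quasi_inverse_sym FG)).
have [e2 [ee2 ee2']] := etai X.
have := etan _ _ (e \oc fmap G g \oc eta X) => /=.
rewrite !compA ee' comp1m => H.
by rewrite -[LHS]compm1 -[RHS]compm1 -ee2' !compA H.
Qed.

(** Each target [Y] is isomorphic to [F (G Y)], so by full faithfulness maps [F S -> Y] are the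
    images of maps [S -> G Y]. *)
Lemma quasi_inverse_preserves_coproducts : preserves_coproducts F.
Proof.
move=> I X S inj Sco; apply: is_coproductP => [Y g|Y f g fg].
  have [e [e' [e'e ee']]] := quasi_inverse_counit FG Y.
  pose g' i := constructive_indefinite_description _
    (quasi_inverse_full (e' \oc g i)).
  have [h hi] := coprod_desc Sco (fun i => sval (g' i)).
  exists (e \oc fmap F h) => i.
  rewrite -compA -fmap_comp hi; case: (g' i) => f /= <-.
  by rewrite compA ee' comp1m.
have [e [e' [e'e ee']]] := quasi_inverse_counit FG Y.
have [f' Ef] := quasi_inverse_full (e' \oc f).
have [g' Eg] := quasi_inverse_full (e' \oc g).
rewrite -[f]comp1m -[g]comp1m -ee' -!compA Ef Eg; congr (_ \oc fmap F _).
apply: (coprod_ext Sco) => i; apply: (quasi_inverse_faithful FG).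
by rewrite !fmap_comp -Ef -Eg -!compA fg.
Qed.

Lemma quasi_inverse_additive : additive_functor F -> additive_functor G.
Proof.
move=> Fadd X Y f g; apply: (quasi_inverse_faithful FG); rewrite Fadd.
have [_ [eps [epsn epsi]]] := FG.
have [e [ee _]] := epsi Y.
rewrite -[LHS]comp1m -[RHS]comp1m -ee -!compA; congr (_ \oc _).
rewrite compBr (epsn _ _ f) (epsn _ _ g) (epsn _ _ (f - g)) /=.
by rewrite compBl.
Qed.

End EquivalenceFull.

(* The hypothesis says that [e] is a universal arrow from [P] to [G]. *)
Lemma compact_universal_arrow (C D : preadditive) (G : functor D C)
    (P : C) (Q : D) (e : hom P (G Q)) :
  additive_functor G -> preserves_coproducts G ->
  (forall Y (b : hom P (G Y)), exists a : hom Q Y, fmap G a \oc e = b) ->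
  (forall Y (a : hom Q Y), fmap G a \oc e = 0 -> a = 0) ->
  compact P -> compact Q.
Proof.
move=> Gadd Gco ex un Pc I X S inj Sco M g.
have un' Y (a a' : hom Q Y) : fmap G a \oc e = fmap G a' \oc e -> a = a'.
  move=> Eaa'; apply/eqP; rewrite -subr_eq0; apply/eqP/un.
  by rewrite Gadd compBl Eaa' subrr.
(* [s] inverts the bijection [a |-> fmap G a \oc e]. Both directions are additive, so the coproduct
   property of [hom P (G S)] is carried over to [hom Q S]. *)
pose s Y (b : hom P (G Y)) := constructive_indefinite_description _ (ex Y b).
have sP Y b : fmap G (sval (s Y b)) \oc e = b by case: (s Y b).
have sadd i : zmod_morphism (fun b : hom P (G (X i)) => g i (sval (s _ b))).
  move=> b b'; rewrite -raddfB; congr (g i _); apply: un'.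
  by rewrite sP Gadd compBl !sP.
pose sA i := GRing.isZmodMorphism.Build _ _ _ (sadd i).
pose g' i : {additive hom P (G (X i)) -> M} :=
  HB.pack (fun b => g i (sval (s _ b))) (sA i).
have [h [hi hu]] := Pc _ _ _ _ (Gco _ _ _ _ Sco) M g'.
have tadd : zmod_morphism (fun a : hom Q S => fmap G a \oc e).
  by move=> a a'; rewrite Gadd compBl.
pose tA := GRing.isZmodMorphism.Build _ _ _ tadd.
pose t : {additive hom Q S -> hom P (G S)} := HB.pack (fun a => fmap G a \oc e) tA.
exists (h \o t : {additive _ -> _}); split=> [i a|h' h'i a] /=.
  rewrite fmap_comp -compA hi /=; congr (g i _); apply: un'.
  by rewrite sP.
have kadd : zmod_morphism (fun b => h' (sval (s S b))).
  move=> b b'; rewrite -raddfB; congr (h' _); apply: un'.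
  by rewrite sP Gadd compBl !sP.
pose kA := GRing.isZmodMorphism.Build _ _ _ kadd.
pose k : {additive hom P (G S) -> M} := HB.pack (fun b => h' (sval (s S b))) kA.
rewrite -(hu k) /=.
  by congr (h' _); apply: un'; rewrite sP.
move=> i b; rewrite -h'i; congr (h' _); apply: un'.
by rewrite sP fmap_comp -compA sP.
Qed.

(** * Triangles and telescopes *)

Section TriangulatedTheory.
Variable D : triangulated.
Implicit Types W X Y Z : D.

Lemma susp_full X Y (g : hom (susp D X) (susp D Y)) :
  exists f : hom X Y, g = fmap (susp D) f.
Proof. exact: quasi_inverse_full (susp_desusp D) X Y g. Qed.

Lemma susp_faithful X Y (f g : hom X Y) :
  fmap (susp D) f = fmap (susp D) g -> f = g.
Proof. exact: quasi_inverse_faithful (susp_desusp D) X Y f g. Qed.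

Lemma susp0 X Y : fmap (susp D) (0 : hom X Y) = 0.
Proof. exact/additive_fmap0/susp_additive. Qed.

Lemma suspN X Y (f : hom X Y) : fmap (susp D) (- f) = - fmap (susp D) f.
Proof. exact/additive_fmapN/susp_additive. Qed.

Lemma suspB X Y (f g : hom X Y) :
  fmap (susp D) (f - g) = fmap (susp D) f - fmap (susp D) g.
Proof. exact: susp_additive. Qed.

Lemma susp_desusp_iso Y : isomorphic (susp D (desusp D Y)) Y.
Proof. exact: quasi_inverse_counit (susp_desusp D) Y. Qed.

Lemma desusp_susp_iso Y : isomorphic (desusp D (susp D Y)) Y.
Proof. exact/isomorphic_sym/(quasi_inverse_unit (susp_desusp D)). Qed.

Lemma susp_preserves_coproducts : preserves_coproducts (susp D).
Proof. exact: quasi_inverse_preserves_coproducts (susp_desusp D). Qed.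

Lemma desusp_preserves_coproducts : preserves_coproducts (desusp D).
Proof.
exact: quasi_inverse_preserves_coproducts (quasi_inverse_sym (susp_desusp D)).
Qed.

Lemma susp_zero X : is_zero X -> is_zero (susp D X).
Proof.
move=> X0; apply: is_zero_id; have [idX0 _] := X0 X.
by rewrite -fmap_id (idX0 (idm X)) susp0.
Qed.

Lemma orth_susp X Y : orth X Y -> orth (susp D X) (susp D Y).
Proof. by move=> oXY f; have [g ->] := susp_full f; rewrite (oXY g) susp0. Qed.

Lemma orth_desusp X Y : orth (susp D X) (susp D Y) -> orth X Y.
Proof. by move=> oXY f; apply: susp_faithful; rewrite susp0; apply: oXY. Qed.

Section Triangle.
Variables (X Y Z : D) (f : hom X Y) (g : hom Y Z) (h : hom Z (susp D X)).
Hypothesis T : dist f g h.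

Lemma dist_rotate2 : dist h (- fmap (susp D) f) (- fmap (susp D) g).
Proof. by have /tri_rotate/tri_rotate := T. Qed.

Lemma dist_susp :
  dist (- fmap (susp D) f) (- fmap (susp D) g) (- fmap (susp D) h).
Proof. by have /tri_rotate := dist_rotate2. Qed.

Lemma dist_opp : dist (- f) (- g) h.
Proof.
apply: (tri_iso (iso_id X) (iso_opp Y) (iso_id Z) _ _ _ T).
- by rewrite compNl comp1m compm1.
- by rewrite compNl compNr opprK comp1m compm1.
by rewrite fmap_id comp1m compm1.
Qed.

Lemma dist_comp0 : g \oc f = 0.
Proof.
have [[O O0] _] := tri_additive D.
have [c [<- _]] := tri_morphism (tri_id X O0) T (erefl (f \oc idm X)).
by rewrite comp0r.
Qed.

End Triangle.

Lemma dist_0_id X O : is_zero O ->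
  dist (0 : hom O X) (idm X) (0 : hom X (susp D O)).
Proof.
move=> O0; apply: (proj2 (tri_rotate _ _ _)); rewrite susp0 oppr0.
by apply: tri_id; apply: susp_zero.
Qed.

Section TriangleExact.
Variables (X Y Z : D) (f : hom X Y) (g : hom Y Z) (h : hom Z (susp D X)).
Hypothesis T : dist f g h.

(** The rotated triangle [W -> 0 -> W[1]] maps to the rotation of [T] by [x] and 0; the third
    component, desuspended, is the lift. *)
Lemma dist_ker W (x : hom W Y) : g \oc x = 0 -> exists y, x = f \oc y.
Proof.
move=> gx; have [[O O0] _] := tri_additive D.
have /tri_rotate T1 := tri_id W O0.
have /tri_rotate T2 := T.
have E : (0 : hom O Z) \oc (0 : hom W O) = g \oc x by rewrite gx comp0l.
have [c [_]] := tri_morphism T1 T2 E.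
have [y ->] := susp_full c.
rewrite fmap_id compNr compNl compm1 => /oppr_inj Ex.
by exists y; apply: susp_faithful; rewrite Ex fmap_comp.
Qed.

Lemma dist_coker W (w : hom Y W) : w \oc f = 0 -> exists v, w = v \oc g.
Proof.
move=> wf; have [[O O0] _] := tri_additive D.
have E : w \oc f = (0 : hom O W) \oc (0 : hom X O) by rewrite wf comp0l.
have [c [Ec _]] := tri_morphism T (dist_0_id W O0) E.
by exists c; rewrite Ec comp1m.
Qed.

End TriangleExact.

Section TriangleLong.
Variables (X Y Z : D) (f : hom X Y) (g : hom Y Z) (h : hom Z (susp D X)).
Hypothesis T : dist f g h.

Lemma dist_comp0'' : fmap (susp D) f \oc h = 0.
Proof.
by apply: oppr_inj; rewrite -compNl (dist_comp0 (dist_rotate2 T)) oppr0.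
Qed.

Lemma dist_ker' W (x : hom W Z) : h \oc x = 0 -> exists y, x = g \oc y.
Proof. by move/tri_rotate: T => T'; apply: (dist_ker T'). Qed.

Lemma dist_ker'' W (x : hom W (susp D X)) :
  fmap (susp D) f \oc x = 0 -> exists y, x = h \oc y.
Proof.
by move=> fx; apply: (dist_ker (dist_rotate2 T)); rewrite compNl fx oppr0.
Qed.

Lemma dist_ker_susp W (x : hom W (susp D Y)) :
  fmap (susp D) g \oc x = 0 -> exists y, x = fmap (susp D) f \oc y.
Proof.
move=> gx; have [|y ->] := dist_ker (dist_susp T) (x := x).
  by rewrite compNl gx oppr0.
by exists (- y); rewrite compNl compNr.
Qed.

Lemma dist_coker' W (w : hom Z W) : w \oc g = 0 -> exists v, w = v \oc h.
Proof. by move/tri_rotate: T => T'; apply: (dist_coker T'). Qed.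

Lemma dist_coker'' W (w : hom (susp D X) W) :
  w \oc h = 0 -> exists v, w = v \oc fmap (susp D) f.
Proof.
move=> wh; have [v ->] := dist_coker (dist_rotate2 T) wh.
by exists (- v); rewrite compNl compNr.
Qed.

Lemma orth_extr S : orth S X -> orth S Z -> orth S Y.
Proof.
move=> oX oZ x; have [|y ->] := dist_ker T (x := x); first exact: oZ.
by rewrite (oX y) comp0r.
Qed.

Lemma orth_extl S : orth X S -> orth Z S -> orth Y S.
Proof.
move=> oX oZ x; have [|y ->] := dist_coker T (w := x); first exact: oX.
by rewrite (oZ y) comp0l.
Qed.

End TriangleLong.

(** The cone of [d] is desuspended. The minus signs on [i] and [q] cancel those of the two
    rotations. *)
Lemma fiber_exists P A (d : hom P (susp D A)) :
  exists (F : D) (i : hom A F) (q : hom F P), dist i q d.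
Proof.
have [Q [p2 [d2 T]]] := tri_cone d.
have [e [e' [e'e ee']]] := susp_desusp_iso Q.
have [i Ei] := susp_full (e' \oc p2).
have [q Eq] := susp_full (d2 \oc e).
exists (desusp D Q), (- i), (- q); apply/tri_rotate/tri_rotate.
rewrite !suspN !opprK -Ei -Eq.
have e'i : is_iso e' by exists e.
apply: (tri_iso (iso_id P) (iso_id _) e'i _ _ _ T).
- by rewrite comp1m compm1.
- by rewrite compm1.
by rewrite fmap_id comp1m -compA ee' compm1.
Qed.

(* The octahedral axiom for P -> B -> A[1]. *)
Lemma dist_attach A X B (a : hom A X) (b : hom X B) (h : hom B (susp D A))
    P (p : hom P B) :
  dist a b h ->
  exists (B' : D) (c : hom B B') (d : hom B' (susp D P))
    (A' : D) (i : hom A A') (q : hom A' P)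
    (a' : hom A' X) (b' : hom X B') (h' : hom B' (susp D A')),
    [/\ dist p c d, dist i q (h \oc p), dist a' b' h' & a' \oc i = a].
Proof.
move=> T; have [B' [c [d Tp]]] := tri_cone p.
have [A' [i [q Ti]]] := fiber_exists (h \oc p).
(* The cones of [p], [h \oc p] and [h] are [B'], [A'[1]] and [X[1]], so [v : A'[1] -> X[1]]
   desuspends to [a']. *)
have [u [v [T' _ _ vi _]]] :=
  tri_octahedral Tp (dist_rotate2 Ti) (dist_rotate2 T).
have [a' Ea'] := susp_full v.
exists B', c, d, A', i, q, a', (- (c \oc b)), u; split=> //.
  rewrite -[a']opprK; apply/dist_opp/tri_rotate/tri_rotate.
  by rewrite suspN opprK -Ea' fmap_comp -compNr.
apply: susp_faithful; apply: oppr_inj.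
by rewrite fmap_comp -Ea' -vi compNr.
Qed.

(** The map from [Z] to the cone of [t] kills [t], hence vanishes, and [idm Z] lifts along [t]. *)
Lemma epi_split Y Z (t : hom Y Z) :
  (forall W (w : hom Z W), w \oc t = 0 -> w = 0) ->
  exists s, t \oc s = idm Z.
Proof.
move=> epi; have [C [g [h T]]] := tri_cone t.
have [|s Es] := dist_ker T (x := idm Z); last by exists s.
by rewrite (epi _ _ (dist_comp0 T)) comp0l.
Qed.

(** By [epi_split] the comparison map [t] need only be epi. A map killing [t] factors through [d']
    as [w']; on each [X i [1]], [w'] extends along [e i [1]]. The extensions assemble on [SY[1]], so
    [w'] factors through [E[1]], which annihilates [d']. *)
Lemma cone_coproduct_retract (I : small) (X Y Z : I -> D)
    (e : forall i, hom (X i) (Y i)) (q : forall i, hom (Y i) (Z i))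
    (d : forall i, hom (Z i) (susp D (X i)))
    (SX SY SZ C : D) (iX : forall i, hom (X i) SX) (iY : forall i, hom (Y i) SY)
    (iZ : forall i, hom (Z i) SZ)
    (E : hom SX SY) (Q : hom SY C) (d' : hom C (susp D SX)) :
  (forall i, dist (e i) (q i) (d i)) ->
  is_coproduct iX -> is_coproduct iY -> is_coproduct iZ ->
  (forall i, E \oc iX i = iY i \oc e i) -> dist E Q d' ->
  exists (t : hom SZ C) (s : hom C SZ), t \oc s = idm C.
Proof.
move=> T coX coY coZ Ei TE.
have th i : exists c : hom (Z i) C, c \oc q i = Q \oc iY i /\
    fmap (susp D) (iX i) \oc d i = d' \oc c.
  by apply: (tri_morphism (T i) TE); rewrite Ei.
pose c i := constructive_indefinite_description _ (th i).
have [t ti] := coprod_desc coZ (fun i => sval (c i)).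
have tq i : t \oc iZ i \oc q i = Q \oc iY i.
  by rewrite ti; case: (c i) => /= x [].
have td i : d' \oc (t \oc iZ i) = fmap (susp D) (iX i) \oc d i.
  by rewrite ti; case: (c i) => /= x [].
exists t; apply: epi_split => W w wt.
have wQ : w \oc Q = 0.
  apply: (coprod_ext coY) => i.
  by rewrite comp0l -compA -tq !compA wt !comp0l.
have [w' Ew] := dist_coker' TE wQ.
have ex i : exists v, w' \oc fmap (susp D) (iX i) = v \oc fmap (susp D) (e i).
  apply: (dist_coker'' (T i)).
  by rewrite -compA -td compA -Ew compA wt comp0l.
pose v i := constructive_indefinite_description _ (ex i).
have [V Vi] := coprod_desc (susp_preserves_coproducts coY) (fun i => sval (v i)).
rewrite Ew.
have -> : w' = V \oc fmap (susp D) E.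
  apply: (coprod_ext (susp_preserves_coproducts coX)) => i.
  rewrite -compA -fmap_comp Ei fmap_comp compA Vi.
  by case: (v i).
by rewrite -compA (dist_comp0'' TE) comp0r.
Qed.

End TriangulatedTheory.

(** [u] is the identity minus the shift map, so its cone is the homotopy colimit of the sequence. *)
Definition telescope (D : triangulated) (A : nat -> D)
    (i : forall m, hom (A m) (A m.+1)) (S : D) (inj : forall m, hom (A m) S)
    (u : hom S S) : Prop :=
  is_coproduct inj /\ forall m, u \oc inj m = inj m - inj m.+1 \oc i m.

(** * Homotopy colimits and the maps into them *)

Section Telescope.
Variable D : triangulated.
Hypothesis Dco : has_coproducts D.

Lemma telescope_exists (A : nat -> D) (i : forall m, hom (A m) (A m.+1)) :
  exists (S : D) (inj : forall m, hom (A m) S) (u : hom S S),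
    telescope i inj u.
Proof.
have [S [inj Sco]] := Dco A.
have [u ui] := coprod_desc Sco (fun m => inj m - inj m.+1 \oc i m).
by exists S, inj, u.
Qed.

Lemma telescope_colim (A : nat -> D) (i : forall m, hom (A m) (A m.+1))
    (S L : D) (inj : forall m, hom (A m) S) (u : hom S S)
    (q : hom S L) (d : hom L (susp D S)) :
  telescope i inj u -> dist u q d ->
  forall m, q \oc inj m.+1 \oc i m = q \oc inj m.
Proof.
move=> [_ ui] T m; apply/esym/eqP.
rewrite -subr_eq0 -(compA q) -compBr -ui compA.
by rewrite (dist_comp0 T) comp0l.
Qed.

(** The map of triangles induced by the inclusion [S1 -> S] is epi on cones, hence split: what
    vanishes on all later terms vanishes on [A 0] as well, because [A 0 -> L] factors through
    [A 1]. *)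
Lemma telescope_tail (A : nat -> D) (i : forall m, hom (A m) (A m.+1))
    (S L : D) (inj : forall m, hom (A m) S) (u : hom S S)
    (q : hom S L) (d : hom L (susp D S))
    (S1 L1 : D) (inj1 : forall m, hom (A m.+1) S1) (u1 : hom S1 S1)
    (q1 : hom S1 L1) (d1 : hom L1 (susp D S1)) :
  telescope i inj u -> dist u q d ->
  telescope (fun m => i m.+1) inj1 u1 -> dist u1 q1 d1 ->
  exists (t : hom L1 L) (s : hom L L1),
    t \oc s = idm L /\ forall m, t \oc (q1 \oc inj1 m) = q \oc inj m.+1.
Proof.
move=> tel T [co1 ui1] T1; have [co ui] := tel.
have [t ti] := coprod_desc co1 (fun m => inj m.+1).
have tu : t \oc u1 = u \oc t.
  apply: (coprod_ext co1) => m.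
  by rewrite -!compA ui1 ti ui compBr compA !ti.
have [c [cq cd]] := tri_morphism T1 T tu.
have [s cs] : exists s, c \oc s = idm L; last first.
  by exists c, s; split=> // m; rewrite compA cq -compA ti.
apply: epi_split => W w wc.
have wqt : w \oc q \oc t = 0 by rewrite -compA -cq compA wc comp0l.
have wq1 m : w \oc q \oc inj m.+1 = 0 by rewrite -ti compA wqt comp0l.
have wq : w \oc q = 0.
  apply: (coprod_ext co) => -[|m]; rewrite comp0l ?wq1 //.
  by rewrite -compA -(telescope_colim tel T) !compA wq1 comp0l.
have [w' Ew] := dist_coker' T wq.
have [v Ev] : exists v, w' \oc fmap (susp D) t = v \oc fmap (susp D) u1.
  by apply: (dist_coker'' T1); rewrite -compA cd compA -Ew.
(* The value at 0 solves the equation [V \oc u[1] = w'] on [A 0 [1]], where [u] subtracts the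
   contribution of [A 1]. *)
pose g m : hom (susp D (A m)) W :=
  match m with
  | 0%N => w' \oc fmap (susp D) (inj 0%N)
             + v \oc fmap (susp D) (inj1 0%N) \oc fmap (susp D) (i 0%N)
  | m.+1 => v \oc fmap (susp D) (inj1 m)
  end.
have [V Vi] := coprod_desc (susp_preserves_coproducts co) g.
rewrite Ew.
have -> : w' = V \oc fmap (susp D) u.
  apply: (coprod_ext (susp_preserves_coproducts co)) => m.
  rewrite -compA -fmap_comp ui suspB compBr fmap_comp compA !Vi.
  case: m => [|m] /=; first by rewrite addrK.
  rewrite -ti fmap_comp compA Ev -compA -fmap_comp ui1 suspB compBr.
  by rewrite fmap_comp compA.
by rewrite -compA (dist_comp0'' T) comp0r.
Qed.

Variable K : D -> Prop.
Hypothesis Kco : closed_coproducts K.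
Hypothesis Kext : forall (X Y Z : D) (f : hom X Y) (g : hom Y Z)
  (h : hom Z (susp D X)), dist f g h -> K X -> K Z -> K Y.
Hypothesis Ksusp : forall X, K X -> K (susp D X).
Hypothesis Kzero : forall O, is_zero O -> K O.

Definition cone_in (X Y : D) (f : hom X Y) : Prop :=
  exists (Z : D) (g : hom Y Z) (h : hom Z (susp D X)), dist f g h /\ K Z.

Lemma cone_in_comp (X Y Z : D) (g : hom Y Z) (f : hom X Y) :
  cone_in f -> cone_in g -> cone_in (g \oc f).
Proof.
move=> [Q1 [p1 [d1 [T1 K1]]]] [Q3 [p3 [d3 [T3 K3]]]].
have [Q2 [p2 [d2 T2]]] := tri_cone (g \oc f).
have [u [v [T _ _ _ _]]] := tri_octahedral T1 T2 T3.
by exists Q2, p2, d2; split=> //; apply: Kext T K1 K3.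
Qed.

(* Compare the telescope of [A] with that of the constant sequence [A 0], whose
   endomorphism [u0] is a split monomorphism with cokernel [A 0]. *)
Lemma telescope_factor0 (A : nat -> D) (i : forall m, hom (A m) (A m.+1))
    (S L : D) (inj : forall m, hom (A m) S) (u : hom S S)
    (q : hom S L) (d : hom L (susp D S)) :
  telescope i inj u -> dist u q d -> (forall m, cone_in (i m)) ->
  forall W, (forall Z, K Z -> orth W Z) ->
  forall x : hom W L, exists z : hom W (A 0%N), x = q \oc inj 0%N \oc z.
Proof.
move=> tel T ci W WK x; have [co ui] := tel.
pose e := fix e m : hom (A 0%N) (A m) :=
  if m is m'.+1 then i m' \oc e m' else idm (A 0%N).
have ce m : cone_in (e m).
  elim: m => [|m IH] /=; last exact: cone_in_comp.
  have [[O O0] _] := tri_additive D.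
  by exists O, 0, 0; split; [apply: tri_id | apply: Kzero].
pose cZ m := constructive_indefinite_description _ (ce m).
pose cg m := constructive_indefinite_description _ (svalP (cZ m)).
pose ch m := constructive_indefinite_description _ (svalP (cg m)).
have [S' [inj' co']] := Dco (fun _ : nat => A 0%N).
have [SZ [injZ coZ]] := Dco (fun m : nat => sval (cZ m)).
have [E Ei] := coprod_desc co' (fun m => inj m \oc e m).
have [C [Q [dE TE]]] := tri_cone E.
have [t [s ts]] := cone_coproduct_retract
  (fun m => proj1 (svalP (ch m))) co' co coZ Ei TE.
have KSZ : K SZ by apply: (Kco coZ) => m; exact: (proj2 (svalP (ch m))).
have WC : orth W C.
  by move=> y; rewrite -[y]comp1m -ts -compA (WK _ KSZ (s \oc y)) comp0r.
have WSC : orth W (susp D C).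
  move=> y; rewrite -[y]comp1m -fmap_id -ts fmap_comp -compA.
  by rewrite (WK _ (Ksusp KSZ) (fmap (susp D) s \oc y)) comp0r.
have [u0 u0i] := coprod_desc co' (fun m => inj' m - inj' m.+1).
(* Differences of consecutive partial sums give back [inj' m], so [r] is a retraction of [u0]; [n]
   is the codiagonal. *)
have [r ri] := coprod_desc co' (fun m => - \sum_(l < m) inj' l).
have [n ni] := coprod_desc co' (fun m => idm (A 0%N)).
have ru0 : r \oc u0 = idm S'.
  apply: (coprod_ext co') => m.
  rewrite -compA u0i compBr !ri big_ord_recr /= opprK comp1m.
  by rewrite addrA addNr add0r.
have Eu : E \oc u0 = u \oc E.
  apply: (coprod_ext co') => m.
  by rewrite -!compA u0i Ei compBr !Ei /= (compA u) ui compBl -!compA.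
have qE : q \oc E = q \oc inj 0%N \oc n.
  apply: (coprod_ext co') => m.
  rewrite -compA Ei -compA ni compm1.
  elim: m => [|m IH] /=; first by rewrite compm1.
  by rewrite -IH !compA (telescope_colim tel T).
(* To see [d \oc x = 0], lift it along [E[1]] to [y]. Then [u0[1] \oc y] is killed by [E[1]], so it
   factors through [C] and vanishes, and [u0[1]] is split mono. Thus [x] comes from [S], and from
   [S'] since [W] has no maps to [C]. *)
have [y Ey] := dist_ker_susp TE (WSC (fmap (susp D) Q \oc (d \oc x))).
have Ey0 : fmap (susp D) E \oc (fmap (susp D) u0 \oc y) = 0.
  rewrite compA -fmap_comp Eu fmap_comp -compA -Ey compA.
  by rewrite (dist_comp0'' T) comp0l.
have [z Ez] := dist_ker'' TE Ey0.
have y0 : y = 0.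
  rewrite -[y]comp1m -fmap_id -ru0 fmap_comp -compA Ez (WC z).
  by rewrite !comp0r.
have [|x' ->] := dist_ker' T (x := x); first by rewrite Ey y0 comp0r.
have [|z' ->] := dist_ker TE (x := x'); first exact: WC.
by exists (n \oc z'); rewrite !compA qE.
Qed.

(** Dropping the first [k] terms reduces to [telescope_factor0], since every map into [L] lifts to
    the homotopy colimit of the tail. *)
Lemma telescope_factor k (A : nat -> D) (i : forall m, hom (A m) (A m.+1))
    (S L : D) (inj : forall m, hom (A m) S) (u : hom S S)
    (q : hom S L) (d : hom L (susp D S)) :
  telescope i inj u -> dist u q d ->
  (forall m, (k <= m)%N -> cone_in (i m)) ->
  forall W, (forall Z, K Z -> orth W Z) ->
  forall x : hom W L, exists z : hom W (A k), x = q \oc inj k \oc z.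
Proof.
elim: k A i S L inj u q d => [|k IH] A i S L inj u q d tel T ci W WK x.
  by apply: (telescope_factor0 tel T) => // m; apply: ci.
have [S1 [inj1 [u1 tel1]]] := telescope_exists (fun m => i m.+1).
have [L1 [q1 [d1 T1]]] := tri_cone u1.
have [t [s [ts tq]]] := telescope_tail tel T tel1 T1.
have [|z Ez] := IH _ _ _ _ _ _ _ _ tel1 T1 _ _ WK (s \oc x).
  by move=> m km; apply: ci.
exists z; rewrite -tq -[x]comp1m -ts -compA Ez.
by rewrite !compA.
Qed.

End Telescope.

(** * Silting objects *)

Section Silting.
Variable D : triangulated.
Implicit Types X Y Z : D.

(** For negative [n] the suspension undoes a desuspension only up to isomorphism. *)
Lemma shift_succ (T : D) (n : int) :
  isomorphic (shift (n + 1) T) (susp D (shift n T)).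
Proof.
case: n => [m|[|m]].
- have -> : Posz m + 1 = Posz m.+1 by lia.
  by exists (idm _); apply: iso_id.
- by apply/isomorphic_sym; apply: susp_desusp_iso.
have -> : Negz m.+1 + 1 = Negz m by lia.
by apply/isomorphic_sym; apply: susp_desusp_iso.
Qed.

Lemma orth_shift_susp (T : D) (n : int) Y :
  orth (shift (n + 1) T) (susp D Y) <-> orth (shift n T) Y.
Proof.
split=> [o|/orth_susp]; last first.
  exact/orth_isol/isomorphic_sym/shift_succ.
by apply: orth_desusp; apply: orth_isol o; apply: shift_succ.
Qed.

Lemma orth_shift_desusp (T : D) (n : int) Y :
  orth (shift n T) (desusp D Y) <-> orth (shift (n + 1) T) Y.
Proof.
rewrite -orth_shift_susp; split; apply: orth_isor; first exact: susp_desusp_iso.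
exact/isomorphic_sym/susp_desusp_iso.
Qed.

Lemma perp_shiftsP (T : D) (N : int -> Prop) Y :
  perp (shifts T N) Y <-> forall n, N n -> orth (shift n T) Y.
Proof. by split=> [p n Nn|o _ [n Nn ->]]; [apply: p; exists n | apply: o]. Qed.

Variable T : D.

(** This is [T[<j]^perp]: for [j = 0] the prospective aisle, in general its [j]-fold shift. *)
Definition below (j : int) Y : Prop := forall l : int, l < j -> orth (shift l T) Y.

Lemma below_perp Y : perp (shifts T (fun n => n < 0)) Y <-> below 0 Y.
Proof. exact: perp_shiftsP. Qed.

Lemma below_le (j k : int) Y : j <= k -> below k Y -> below j Y.
Proof. by move=> jk b l lj; apply: b; lia. Qed.

Lemma below_ext j X Y Z (f : hom X Y) (g : hom Y Z) (h : hom Z (susp D X)) :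
  dist f g h -> below j X -> below j Z -> below j Y.
Proof.
by move=> TT bX bZ l lj; apply: (orth_extr TT); [apply: bX | apply: bZ].
Qed.

Lemma below_zero j O : is_zero O -> below j O.
Proof. by move=> O0 l _; have [] := O0 (shift l T). Qed.

Lemma below_susp_succ j Y : below j Y -> below (j + 1) (susp D Y).
Proof.
move=> b l lj; have -> : l = (l - 1) + 1 by lia.
by apply/orth_shift_susp; apply: b; lia.
Qed.

Lemma below_susp j Y : below j Y -> below j (susp D Y).
Proof. by move/below_susp_succ; apply: below_le; lia. Qed.

Lemma below_desusp j Y : below (j + 1) Y <-> below j (desusp D Y).
Proof.
split=> b l lj; first by apply/orth_shift_desusp; apply: b; lia.
have -> : l = (l - 1) + 1 by lia.
by apply/orth_shift_desusp; apply: b; lia.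
Qed.

Lemma below_summand j : closed_summands (below j).
Proof. by move=> A X AX b l lj; apply: orth_summand AX _; apply: b. Qed.

Lemma below_shift (k : nat) : below 0 T -> below k%:Z (shift k%:Z T).
Proof.
move=> b; elim: k => // k IH.
by have := below_susp_succ IH; have -> : Posz k + 1 = Posz k.+1 by lia.
Qed.

Lemma below_coproducts (k : nat) :
  closed_coproducts (below 0) -> closed_coproducts (below k%:Z).
Proof.
move=> c; elim: k => // k IH I X S inj co bX.
have E : Posz k.+1 = Posz k + 1 by lia.
rewrite E; apply/below_desusp.
apply: (IH _ _ _ _ (desusp_preserves_coproducts co)) => i.
by apply/below_desusp; rewrite -E.
Qed.

Definition above Y : Prop := forall l : int, 0 <= l -> orth (shift l T) Y.

Lemma above_perp Y : perp (shifts T (fun n => 0 <= n)) Y <-> above Y.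
Proof. exact: perp_shiftsP. Qed.

Lemma above_summand : closed_summands above.
Proof. by move=> A X AX b l lj; apply: orth_summand AX _; apply: b. Qed.

Lemma above_desusp Y : above Y -> above (desusp D Y).
Proof. by move=> a l l0; apply/orth_shift_desusp; apply: a; lia. Qed.

(** Orthogonality of [below 0] to [above] becomes available only after the approximation is built,
    so membership in this left orthogonal is tracked separately. *)
Definition left_above X : Prop := forall V, above V -> orth X V.

Lemma left_above_susp X : left_above X -> left_above (susp D X).
Proof.
move=> a V aV; apply: orth_isor (susp_desusp_iso V) _.
by apply: orth_susp; apply: a; apply: above_desusp.
Qed.

Hypothesis Dco : has_coproducts D.
Hypothesis Tb : below 0 T.
Hypothesis Tco : closed_coproducts (below 0).

(** * Approximation of an object by the prospective aisle *)

Section Approximation.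
Variable X : D.

Record stage := Stage {
  src : D; to_X : hom src X; cofib : D;
  from_X : hom X cofib; bd : hom cofib (susp D src);
  stage_dist : dist to_X from_X bd
}.

Definition good (k : nat) (s : stage) : Prop :=
  [/\ below 0 (src s), left_above (src s)
    & forall j : int, 0 <= j < k%:Z -> orth (shift j T) (cofib s)].

Definition refines (k : nat) (s s' : stage) : Prop :=
  exists2 i : hom (src s) (src s'), to_X s' \oc i = to_X s
    & cone_in (below k%:Z) i.

Lemma stage0 : exists s, good 0 s.
Proof.
have [[O O0] _] := tri_additive D.
have [Z [g [h TT]]] := tri_cone (0 : hom O X).
exists (Stage TT); split=> /=; first exact: below_zero.
  by move=> V _; have [] := O0 V.
by move=> j jj; exfalso; lia.
Qed.

Lemma stageS k s : good k s -> exists s', good k.+1 s' /\ refines k s s'.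
Proof.
case: s => A a B b h TT [/= Ab Ala Bv].
(* One copy of [T[k]] for each map [T[k] -> B], so that every such map factors through [p]. *)
have [P [inj Pco]] := Dco (fun _ : hom (shift k%:Z T) B => shift k%:Z T).
have [p pf] := coprod_desc Pco (fun f => f).
have [B' [c [d [A' [i [q [a' [b' [h' [Tp Ti Ta' a'i]]]]]]]]]] :=
  dist_attach p TT.
have Pb : below k%:Z P.
  by apply: (below_coproducts Tco Pco) => _; apply: below_shift.
exists (Stage Ta'); split; last by exists i => //=; exists P, q, (h \oc p).
split=> /=.
- by apply: (below_ext Ti) => //; apply: below_le Pb; lia.
- move=> V aV; apply: (orth_extl Ti); first exact: Ala.
  by apply: (orth_coprod Pco) => _; apply: aV; lia.
(* As [P[1]] lies in [below (k+1)] and [j <= k], [x] lifts to [y : T[j] -> B]. This is zero by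
   induction for [j < k]; for [j = k] it factors through [p], which [c] kills. *)
move=> j jk x.
have [|y ->] := dist_ker' Tp (x := x).
  by apply: (below_susp_succ Pb); lia.
have [jk'|jk'] := eqVneq j k%:Z; last first.
  by rewrite (Bv j _ y) ?comp0r //; lia.
move: y; rewrite jk' => y; rewrite -(pf y) compA (dist_comp0 Tp).
by rewrite comp0l.
Qed.

Lemma below_above_approximation :
  exists (A B : D) (f : hom A X) (g : hom X B) (h : hom B (susp D A)),
    [/\ below 0 A, left_above A, above B & dist f g h].
Proof.
pose G k := {s | good k s}.
have nxt k (s : G k) : {s' : G k.+1 | refines k (sval s) (sval s')}.
  apply: constructive_indefinite_description.
  by have [s' [g r]] := stageS (svalP s); exists (exist _ s' g).
pose s0 : G 0%N := constructive_indefinite_description _ stage0.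
pose sq := nat_rect G s0 (fun k s => sval (nxt k s)).
pose A k := src (sval (sq k)); pose a k := to_X (sval (sq k)).
have ri k : refines k (sval (sq k)) (sval (sq k.+1)) := svalP (nxt k (sq k)).
have ri' k : exists i : hom (A k) (A k.+1),
    a k.+1 \oc i = a k /\ cone_in (below k%:Z) i.
  by have [i E c] := ri k; exists i.
pose ci k := constructive_indefinite_description _ (ri' k).
pose i k := sval (ci k).
have ai k : a k.+1 \oc i k = a k by have [] := svalP (ci k).
have icone k : cone_in (below k%:Z) (i k) by have [] := svalP (ci k).
have Ab k : below 0 (A k) by have [] := svalP (sq k).
have Ala k : left_above (A k) by have [] := svalP (sq k).
have Bv k (j : int) : 0 <= j < k%:Z -> orth (shift j T) (cofib (sval (sq k))).
  by have [_ _] := svalP (sq k); apply.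
have [S [inj [u tel]]] := telescope_exists Dco i.
have [L [q [d TL]]] := tri_cone u.
have [co ui] := tel.
have Lb : below 0 L.
  have Sb : below 0 S by apply: (Tco co).
  have TL' := proj1 (tri_rotate _ _ _) TL.
  by apply: (below_ext TL' Sb); apply: below_susp.
have Lla : left_above L.
  have Sla : left_above S by move=> V aV; apply: (orth_coprod co) => k; apply: Ala.
  have TL' := proj1 (tri_rotate _ _ _) TL.
  move=> V aV; apply: (orth_extl TL'); first exact: Sla.
  exact: (left_above_susp Sla).
have [a0 a0i] := coprod_desc co a.
have [aL EaL] : exists aL, a0 = aL \oc q.
  apply: (dist_coker TL); apply: (coprod_ext co) => m.
  by rewrite comp0l -compA ui compBr compA !a0i ai subrr.
have aLi k : aL \oc (q \oc inj k) = a k by rewrite compA -EaL a0i.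
have [B [b [h TB]]] := tri_cone aL.
exists L, B, aL, b, h; split=> // j j0 x.
(* From stage [k] on the connecting cones lie in [below k], which receives no maps from [T[l]]. *)
have LA (l : int) (k : nat) (z : hom (shift l T) L) : l < k%:Z ->
    exists z', z = q \oc inj k \oc z'.
  move=> lk; apply: (telescope_factor Dco (below_coproducts (k := k) Tco)
    (@below_ext _) (@below_susp _) (@below_zero _) tel TL).
    by move=> m km; have [Z [g [e [Te bZ]]]] := icone m;
      exists Z, g, e; split=> //; apply: below_le bZ; lia.
  by move=> Z; apply.
(* Stage [j + 1] is late enough for both uses: its cofibre has no maps from [T[j]], and maps [T[j-1]
   -> L] factor through its source. *)
have [k Ek] : exists k : nat, k%:Z = j + 1 by exists (absz (j + 1)); lia.
(* Desuspending gives [z : T[j-1] -> L] killed by [aL]. For [j = 0] it vanishes because [L] is in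
   [below 0]. Otherwise it factors as [z'] through [A k], and [z'[1]] factors through a map from
   [T[j]] to the cofibre of stage [k], which is zero. *)
have hx : h \oc x = 0.
  have [e [e' [e'e ee']]] := shift_succ T (j - 1).
  rewrite subrK in e e' e'e ee'.
  have [z Ez] := susp_full (h \oc x \oc e').
  suff z0 : z = 0 by rewrite -[x]compm1 -e'e !compA Ez z0 susp0 comp0l.
  have az : aL \oc z = 0.
    apply: susp_faithful; rewrite fmap_comp -Ez susp0 !compA.
    by rewrite (dist_comp0'' TB) !comp0l.
  have [j1|j1] : j - 1 < 0 \/ 0 <= j - 1 by lia.
    exact: Lb.
  have [|z' Ez'] := LA _ k z; first by lia.
  rewrite Ez' compA aLi in az.
  have [y Ey] : exists y, fmap (susp D) z' = bd (sval (sq k)) \oc y.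
    apply: (dist_ker'' (stage_dist (sval (sq k)))).
    by rewrite -fmap_comp az susp0.
  have o : orth (susp D (shift (j - 1) T)) (cofib (sval (sq k))).
    apply: orth_isol (shift_succ T (j - 1)) _.
    by rewrite subrK; apply: Bv; lia.
  rewrite Ez'; suff -> : z' = 0 by rewrite !comp0r.
  by apply: susp_faithful; rewrite Ey (o y) comp0r susp0.
(* Now [x] comes from [x' : T[j] -> X], which factors through [A k], hence through [aL], and is
   killed by [b]. *)
have [x' ->] := dist_ker' TB hx.
have [|x'' ->] := dist_ker (stage_dist (sval (sq k))) (x := x').
  by apply: (Bv k j); lia.
rewrite -[to_X _]/(a k) -aLi !compA (dist_comp0 TB).
by rewrite !comp0l.
Qed.

End Approximation.

Lemma silting_of_below : generator T -> silting T.
Proof.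
move=> gen.
(* The cone [B'] of the approximation of [A] is in both [below 0] and [above], so it is zero because
   [T] generates; [A] then inherits orthogonality from [A']. *)
have orthUV A B : below 0 A -> above B -> orth A B.
  move=> Ab Ba; have [A' [B' [f [g [h [A'b A'la B'a TT]]]]]] :=
    below_above_approximation A.
  have TT' := proj1 (tri_rotate _ _ _) TT.
  have B'b : below 0 B' by apply: (below_ext TT') => //; apply: below_susp.
  have B'0 : is_zero B'.
    apply/(gen B')/perp_shiftsP => n _.
    have [n0|n0] : n < 0 \/ 0 <= n by lia.
      exact: B'b.
    exact: B'a.
  apply: (orth_extl TT); first exact: A'la.
  by have [] := B'0 B.
split; last first.
  by move=> X /below_perp Xb; apply/below_perp; apply: below_susp.
split.
- by move=> A X AX /below_perp Xb; apply/below_perp; apply: below_summand Xb.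
- by move=> A X AX /above_perp Xb; apply/above_perp; apply: above_summand Xb.
- by move=> A B /below_perp Ab /above_perp Ba; apply: orthUV.
move=> X; have [A [B [f [g [h [Ab _ Ba TT]]]]]] := below_above_approximation X.
by exists A, B, f, g, h; split=> //; [apply/below_perp | apply/above_perp].
Qed.

End Silting.

(** * Adjunctions, compactness and purity *)

(** In the torsion triangle of [T] the map [T -> B] vanishes, [B] being orthogonal to [T[0]]; so [T]
    is a retract of [A]. *)
Lemma below_of_silting (D : triangulated) (T : D) : silting T -> below T 0 T.
Proof.
move=> [[_ _ _ ap] _] l l0.
have [A [B [f [g [h [/below_perp Ab /above_perp Ba TT]]]]]] := ap T.
have [|s fs] := dist_ker TT (x := idm T); first exact: (Ba 0).
by move=> x; rewrite -[x]comp1m fs -compA (Ab l l0 (s \oc x)) comp0r.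
Qed.

(** An object orthogonal to all shifts of [T] lies in both halves of the torsion pair, so its
    identity is zero. *)
Lemma generator_of_silting (D : triangulated) (T : D) : silting T -> generator T.
Proof.
move=> [[_ _ o _] _] Y; split=> [/perp_shiftsP p|Y0]; last first.
  by apply/perp_shiftsP => n _; have [] := Y0 (shift n T).
apply: is_zero_id; apply: o; apply/perp_shiftsP => n _; exact: p.
Qed.

Section Adjoint.
Variables (C D : preadditive) (F : functor C D) (G : functor D C).
Hypothesis adj : adjunction F G.

Lemma adjoint_transpose X Y (b : hom X (G Y)) :
  exists a : hom (F X) Y, fmap G a \oc unit adj X = b.
Proof.
exists (counit adj Y \oc fmap F b).
have /= n := unit_natural adj b.
by rewrite fmap_comp -compA -n compA (counit_unit adj) comp1m.
Qed.

Lemma adjoint_transpose_inj X Y (a a' : hom (F X) Y) :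
  fmap G a \oc unit adj X = fmap G a' \oc unit adj X -> a = a'.
Proof.
have E (x : hom (F X) Y) : x = counit adj Y \oc fmap F (fmap G x \oc unit adj X).
  have /= n := counit_natural adj x.
  by rewrite fmap_comp compA n -compA (unit_counit adj) compm1.
by move=> e; rewrite [a]E e -E.
Qed.

Hypothesis Gadd : additive_functor G.

Lemma adjoint_transpose0 X Y (a : hom (F X) Y) :
  fmap G a \oc unit adj X = 0 -> a = 0.
Proof.
by move=> a0; apply: adjoint_transpose_inj; rewrite a0 additive_fmap0 // comp0l.
Qed.

Lemma orth_adjoint X Y : orth (F X) Y <-> orth X (G Y).
Proof.
split=> o f; last by apply: adjoint_transpose0; apply: o.
have [a <-] := adjoint_transpose f.
by rewrite (o a) additive_fmap0 // comp0l.
Qed.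

(** By naturality of the unit, [unit adj X \oc f] is the transpose of [fmap F f]. *)
Lemma adjoint_fmap_eq0 W X (f : hom W X) : unit adj X \oc f = 0 -> fmap F f = 0.
Proof.
by move=> f0; apply: adjoint_transpose0; rewrite -[LHS](unit_natural adj f).
Qed.

Lemma compact_adjoint P : preserves_coproducts G -> compact P -> compact (F P).
Proof.
move=> Gco Pc.
apply: (@compact_universal_arrow _ _ G P (F P) (unit adj P)) => //.
  by move=> Y b; apply: adjoint_transpose.
by move=> Y a; apply: adjoint_transpose0.
Qed.

End Adjoint.

(** For an equivalence [G], an isomorphism [P -> G Q] is a universal arrow. *)
Lemma compact_quasi_inverse (C D : preadditive) (F : functor C D)
    (G : functor D C) (P : C) (Q : D) :
  quasi_inverse G F -> additive_functor G -> isomorphic P (G Q) ->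
  compact P -> compact Q.
Proof.
move=> GF Gadd [e [e' [e'e ee']]] Pc.
apply: (compact_universal_arrow (e := e)) => //.
- exact: quasi_inverse_preserves_coproducts GF.
- move=> Y b; have [a Ea] := quasi_inverse_full GF (b \oc e').
  by exists a; rewrite -Ea -compA e'e compm1.
move=> Y a a0; apply: (quasi_inverse_faithful GF).
by rewrite additive_fmap0 // -[LHS]compm1 -ee' compA a0 comp0l.
Qed.

Section CompactShift.
Variable D : triangulated.
Implicit Types P : D.

Lemma compact_susp P : compact P -> compact (susp D P).
Proof.
have sd := susp_desusp D.
move=> Pc; apply: (compact_quasi_inverse (quasi_inverse_sym sd) _ _ Pc).
  exact/(quasi_inverse_additive sd)/susp_additive.
exact/isomorphic_sym/desusp_susp_iso.
Qed.

Lemma compact_desusp P : compact P -> compact (desusp D P).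
Proof.
move=> Pc; apply: (compact_quasi_inverse (susp_desusp D) _ _ Pc).
  exact: susp_additive.
exact/isomorphic_sym/susp_desusp_iso.
Qed.

Lemma compact_shift P n : compact P -> compact (shift n P).
Proof.
move=> Pc; case: n => m /=; first by elim: m => //= m; apply: compact_susp.
apply: compact_desusp.
by elim: m => //= m; apply: compact_desusp.
Qed.

(** The identity and the zero map of [hom P S] both restrict to the zero family, so uniqueness
    equates them. *)
Lemma compact_orth_coproduct P (I : small) (X : I -> D) (S : D)
    (inj : forall i, hom (X i) S) :
  compact P -> is_coproduct inj -> (forall i, orth P (X i)) -> orth P S.
Proof.
move=> Pc Sco o f.
have [h [hi hu]] := Pc _ _ _ _ Sco (hom P S) (fun i => \0 : {additive _ -> _}).
rewrite -[f]/((idfun : {additive hom P S -> hom P S}) f).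
rewrite (hu idfun) => [|i a] /=; last by rewrite (o i a) comp0r.
rewrite -(hu (\0 : {additive _ -> _})) //.
Qed.

Lemma compact_below_coproducts T :
  compact T -> closed_coproducts (below T (0 : int) : D -> Prop).
Proof.
move=> Tc I X S inj Sco Xb l l0.
exact: (compact_orth_coproduct (compact_shift (n := l) Tc) Sco (fun i => Xb i l l0)).
Qed.

Lemma compact_below_pure T :
  compact T -> closed_pure_subobjects (below T (0 : int) : D -> Prop).
Proof.
move=> Tc X Y [Z [f [g [h [_ ex]]]]] Yb l l0 x.
have [finj _ _] := ex _ (compact_shift (n := l) Tc).
by apply: finj; rewrite raddf0; apply: Yb.
Qed.

End CompactShift.

(** * Descent along the adjunction *)

Section Descent.
Variables (D1 D2 : triangulated) (phi_low : triangle_functor D2 D1).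
Variables (phi_up : functor D1 D2) (adj : adjunction phi_up phi_low).

Lemma below_adjoint (T : D1) (Y : D2) :
  below (phi_up T) 0 Y -> below T 0 (phi_low Y).
Proof.
(* Desuspensions cross the adjunction one at a time through [phi_low], which commutes with
   suspension; [Z] varies because the induction passes to [Z[1]]. *)
have step m Z : orth (iter m (desusp D2) (phi_up T)) Z ->
    orth (iter m (desusp D1) T) (phi_low Z).
  elim: m Z => [|m IH] Z /=.
    by move/(orth_adjoint adj (tfunctor_additive phi_low)).
  move=> o; apply: orth_desusp.
  apply: orth_isol (isomorphic_sym (susp_desusp_iso _)) _.
  apply: orth_isor (IH (susp D2 Z) _).
    exists (tfunctor_susp phi_low Z).
    by have [_] := tfunctor_susp_iso phi_low; apply.
  apply: orth_isol (susp_desusp_iso _) _.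
  exact: orth_susp.
by move=> b [m|m] l0 //; apply: step; apply: (b (Negz m)).
Qed.

Hypothesis qff : quasi_faithfully_flat adj.

(* phi_up kills every map killed by the unit, so such maps are phantom. *)
Lemma unit_pure (T : D1) : pure_subobject T (phi_low (phi_up T)).
Proof.
have inj P (x : hom P T) : compact P -> unit adj T \oc x = 0 -> x = 0.
  move=> Pc x0; rewrite -[x]compm1; apply: (qff _ Pc) => Q Qc y.
  by rewrite (adjoint_fmap_eq0 (tfunctor_additive phi_low) x0) comp0l.
have [Z [g [h TT]]] := tri_cone (unit adj T).
exists Z, (unit adj T), g, h; split=> // P Pc; split=> /=.
- by apply: raddf_inj => x; apply: inj.
- move=> b; split=> [/(dist_ker TT) [y ->]|[a <-]]; first by exists y.
  by rewrite compA (dist_comp0 TT) comp0l.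
(* For surjectivity, [h \oc m : P -> T[1]] desuspends to a map from a compact object to [T] killed
   by the unit, hence zero. *)
move=> m; suff /(dist_ker' TT) [y ->] : h \oc m = 0 by exists y.
have [e [e' [e'e ee']]] := susp_desusp_iso P.
have [y Ey] := susp_full (h \oc m \oc e).
have y0 : y = 0.
  apply: inj; first exact: compact_desusp.
  apply: susp_faithful; rewrite fmap_comp -Ey susp0 !compA.
  by rewrite (dist_comp0'' TT) !comp0l.
by rewrite -[_ \oc _]compm1 -ee' compA Ey y0 susp0 comp0l.
Qed.

End Descent.

Theorem theorem5p1 (D1 D2 : triangulated)
  (D1_cg : compactly_generated D1) (D2_cg : compactly_generated D2)
  (phi_low : triangle_functor D2 D1) (phi_up : functor D1 D2)
  (adj : adjunction phi_up phi_low)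
  (phi_low_coprod : preserves_coproducts phi_low)
  (phi_qff : quasi_faithfully_flat adj)
  (T1 : D1) :
  let T2 : D2 := phi_up T1 in
  let T1_neg_perp : D1 -> Prop := perp (shifts T1 (fun n : int => n < 0)) in
  (generator T1 ->
   closed_pure_subobjects T1_neg_perp ->
   closed_coproducts T1_neg_perp ->
   silting T2 -> silting T1)
  /\
  (compact_generator T1 ->
   [/\ generator T1, closed_pure_subobjects T1_neg_perp
     & closed_coproducts T1_neg_perp] /\
   compact T2 /\ (silting T2 -> generator T2)).
Proof.
move=> T2 T1_neg_perp; split.
  move=> T1gen T1pure T1co /below_of_silting/(below_adjoint adj) T2b.
  have [D1co _ _] := D1_cg.
  apply: silting_of_below => //.
    apply/below_perp; apply: (T1pure _ _ (unit_pure phi_qff T1)).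
    exact/below_perp.
  move=> I X S inj Sco Xb; apply/below_perp; apply: (T1co _ _ _ _ Sco) => i.
  exact/below_perp.
move=> [T1c T1gen]; split; last split.
- split=> //.
    move=> X Y XY /below_perp Yb; apply/below_perp.
    exact: compact_below_pure XY Yb.
  move=> I X S inj Sco Xb; apply/below_perp.
  apply: (compact_below_coproducts T1c Sco) => i; apply/below_perp; exact: Xb.
- exact: (compact_adjoint adj (tfunctor_additive phi_low) phi_low_coprod T1c).
(* Generation rests on [T2] being silting: for the projection of a product of [D1] with a nonzero
   [D'] onto [D1], [T2] is [(T1, 0)], which is compact but does not generate. *)
exact: generator_of_silting.
Qed.
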